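(* Let $A\in\mathbb{Z}^{d\times n}$, $c\in\mathbb{R}^n$, and $F(A)=\{b_1,\dots,b_k\}$. Let $z_1^{opt},\dots,z_k^{opt}$ be optimal solutions to the integer programs \[ \min\{c^\intercal z: Az=b_i,\ z\in\mathbb{Z}^n_+\},\qquad i=1,\dots,k, \] and let $b\in\mathbb{Z}^d$ be such that the problem \[ \min\{c^\intercal z: Az=b,\ z\in\mathbb{Z}^n_+\} \] is solvable. If $P^I_{A,b}=\bigoplus_{i=1}^{k}\alpha_i P^I_{A,b_i}$ with $\alpha_1,\dots,\alpha_k\in\mathbb{Z}_+$, then $\bar z:=\sum_{i=1}^k\alpha_i z_i^{opt}$ is an optimal solution to $\min\{c^\intercal z: Az=b,\ z\in\mathbb{Z}^n_+\}$.
   Context: $\mathbb{Z}_+$ denotes the nonnegative integers. For $u,v\in\mathbb{R}^n$ write $u\sqsubseteq v$ if $u^{(j)}v^{(j)}\ge 0$ and $|u^{(j)}|\le |v^{(j)}|$ for all components $j=1,\dots,n$. For $S,T,U\subseteq\mathbb{R}^n$ write $S=T\oplus U$ if for every $z\in S$ there are $z_1\in T$ and $z_2\in U$ with $z_1\sqsubseteq z$, $z_2\sqsubseteq z$ and $z=z_1+z_2$. For $A\in\mathbb{Z}^{d\times n}$ and $b\in\mathbb{Z}^d$, the fiber of $b$ is $P^I_{A,b}:=\{z\in\mathbb{Z}^n_+: Az=b\}$. The fiber $P^I_{A,b}$ is called atomic if it cannot be written as $P^I_{A,b}=P^I_{A,b_1}\oplus P^I_{A,b_2}$ with two other fibers $P^I_{A,b_1}$,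 $P^I_{A,b_2}$ (i.e. with $b_1,b_2\in\mathbb{Z}^d$, $b_1\neq b$ and $b_2\ne b$). In particular, empty fibers are not atomic, since they decompose vacuously. $F(A)$ denotes the set of right-hand sides $b$ for which $P^I_{A,b}$ is atomic; it is a known fact that $F(A)$ is finite. The notation $P^I_{A,b}=\bigoplus_{i=1}^k\alpha_iP^I_{A,b_i}$ means the iterated $\oplus$-decomposition in which $P^I_{A,b_i}$ occurs as a summand $\alpha_i$ times: every $z\in P^I_{A,b}$ can be written as $z=\sum_{i=1}^k\sum_{l=1}^{\alpha_i} z_{i,l}$ with $z_{i,l}\in P^I_{A,b_i}$ and $z_{i,l}\sqsubseteq z$ (empty sums being $0$). *)

(* Defs.v *)
From HB Require Import structures.
From mathcomp Require Import all_boot all_order all_algebra.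
From mathcomp Require Import classical_sets reals.
Set Implicit Arguments.
Unset Strict Implicit.
Unset Printing Implicit Defensive.
Import Order.TTheory GRing.Theory Num.Theory.
Local Open Scope classical_set_scope.
Local Open Scope ring_scope.

(* The order u ⊑ v, over any ordered domain so that it applies to integer
   vectors directly. *)
Definition conformal_le (K : realDomainType) (n : nat) (u v : 'cV[K]_n) : Prop :=
  forall j, 0 <= u j 0 * v j 0 /\ `|u j 0| <= `|v j 0|.

(* The relation S = T ⊕ U; only one inclusion is required: T and U may have
   elements whose sum is not in S. *)
Definition is_oplus (K : realDomainType) (n : nat) (S T U : set 'cV[K]_n) : Prop :=
  forall z, S z -> exists z1 z2,
    [/\ T z1, U z2, conformal_le z1 z, conformal_le z2 z & z = z1 + z2].

(* The relation S = ⊕_i α_i T_i, where T_i occurs α_i times as a summand. *)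
Definition is_bigoplus (K : realDomainType) (n k : nat) (S : set 'cV[K]_n)
    (alpha : 'I_k -> nat) (T : 'I_k -> set 'cV[K]_n) : Prop :=
  forall z, S z -> exists y : forall i : 'I_k, 'I_(alpha i) -> 'cV[K]_n,
    (forall i l, T i (y i l) /\ conformal_le (y i l) z) /\
    z = \sum_(i < k) \sum_(l < alpha i) y i l.

Definition fiber (d n : nat) (A : 'M[int]_(d, n)) (b : 'cV[int]_d) :
    set 'cV[int]_n :=
  [set z : 'cV[int]_n | (forall j, 0 <= z j 0) /\ A *m z = b].

Definition atomic_fiber (d n : nat) (A : 'M[int]_(d, n)) (b : 'cV[int]_d) : Prop :=
  ~ exists b1 b2 : 'cV[int]_d,
      [/\ b1 <> b, b2 <> b & is_oplus (fiber A b) (fiber A b1) (fiber A b2)].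

Definition atomic_rhs (d n : nat) (A : 'M[int]_(d, n)) : set 'cV[int]_d :=
  [set b | atomic_fiber A b].

Definition cost (R : realType) (n : nat) (c : 'cV[R]_n) (z : 'cV[int]_n) : R :=
  (c^T *m map_mx intr z) 0 0.

Definition ip_optimal (R : realType) (d n : nat) (A : 'M[int]_(d, n))
    (c : 'cV[R]_n) (b : 'cV[int]_d) (z : 'cV[int]_n) : Prop :=
  fiber A b z /\ forall w, fiber A b w -> cost c z <= cost c w.

(* Solvable means that the minimum is attained; since c is real, this is
   stronger than being feasible and bounded below. *)
Definition ip_solvable (R : realType) (d n : nat) (A : 'M[int]_(d, n))
    (c : 'cV[R]_n) (b : 'cV[int]_d) : Prop :=
  exists z, ip_optimal A c b z.

(* Main.v *)
(* Replacing each summand of a decomposition of a feasible point by the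
   optimum of its fiber preserves the right-hand side and does not increase
   the cost; solvability provides a feasible point to start from. *)
Require Import Defs.
From mathcomp Require Import all_boot all_order all_algebra.
From mathcomp Require Import classical_sets reals.
Import GRing.Theory Num.Theory.
Local Open Scope classical_set_scope.
Local Open Scope ring_scope.

Lemma cost_sum (R : realType) (n : nat) (c : 'cV[R]_n) (I : Type) (r : seq I)
    (z : I -> 'cV[int]_n) :
  cost c (\sum_(i <- r) z i) = \sum_(i <- r) cost c (z i).
Proof. by rewrite /cost raddf_sum mulmx_sumr summxE. Qed.

Theorem lemma3p2 (R : realType) (d n k : nat) (A : 'M[int]_(d, n))
    (c : 'cV[R]_n) (bs : 'I_k -> 'cV[int]_d)
    (F_A : atomic_rhs A = range bs)
    (zopt : 'I_k -> 'cV[int]_n)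
    (zopt_optimal : forall i : 'I_k, ip_optimal A c (bs i) (zopt i))
    (b : 'cV[int]_d) (b_solvable : ip_solvable A c b)
    (alpha : 'I_k -> nat)
    (b_decomp : is_bigoplus (fiber A b) alpha (fun i => fiber A (bs i))) :
  ip_optimal A c b (\sum_(i < k) zopt i *+ alpha i).
Proof.
(* Unfolding the multiples gives the sum the same double index as a decomposition, so both can be
   compared term by term. *)
have -> : \sum_(i < k) zopt i *+ alpha i =
    \sum_(i < k) \sum_(l < alpha i) zopt i.
  by apply: eq_bigr => i _; rewrite sumr_const card_ord.
split.
  have [w [Fw _]] := b_solvable.
  have [y [Fy w_eq]] := b_decomp w Fw.
  split=> [j|].
    rewrite summxE; apply: sumr_ge0 => i _.
    rewrite summxE; apply: sumr_ge0 => l _.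
    by have [[z_ge0 _] _] := zopt_optimal i.
  (* With [b] written as [A *m w], both sides are double sums whose terms all equal [bs i]. *)
  rewrite -(proj2 Fw) w_eq !mulmx_sumr; apply: eq_bigr => i _.
  rewrite !mulmx_sumr; apply: eq_bigr => l _.
  have [[_ ->] _] := zopt_optimal i.
  by have [[_ ->] _] := Fy i l.
(* Each competitor [w] is decomposed afresh; its piece [y i l] is feasible for the program that
   [zopt i] solves. *)
move=> w /b_decomp[y [Fy ->]]; rewrite !cost_sum.
apply: ler_sum => i _; rewrite !cost_sum; apply: ler_sum => l _.
have [_ zopt_min] := zopt_optimal i.
by apply: zopt_min; have [] := Fy i l.
Qed.
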